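(* Let $n\ge 2$, let $B,C$ be $n\times n$ generic matrices over $\mathbb{Q}$, let $K$ be the field generated over $\mathbb{Q}$ by all their entries and $\overline{K}$ its algebraic closure. The equation $$X^2+BX+XB+C=0_n$$ admits $2^n$ distinct solutions in the unknown $X\in\mathcal{M}_n(\overline{K})$. If $n\le 4$, then this equation is solvable.
   Context: Generic matrices: matrices whose entries, taken all together, are independent commuting indeterminates over $\mathbb{Q}$ (algebraically independent over $\mathbb{Q}$). Solvable: when a matrix equation over $K$ has a finite positive number of solutions in $\mathcal{M}_n(\overline{K})$, it is called solvable if the entries of each solution can be calculated by radicals over $K$ (i.e. lie in a radical extension of $K$), and non-solvable otherwise. *)

(* Defs.v *)
From HB Require Import structures.
From mathcomp Require Import all_boot all_order all_algebra.
From mathcomp Require Import mpoly.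

Set Implicit Arguments.
Unset Strict Implicit.
Unset Printing Implicit Defensive.

Import GRing.Theory.
Local Open Scope ring_scope.

(* Subsets of a field are Prop-valued, so that the subfield generated by an
   arbitrary subset exists without any decidability assumption. *)
Inductive gen_subfield (F : fieldType) (S : F -> Prop) : F -> Prop :=
| gen_incl x : S x -> gen_subfield S x
| gen_one : gen_subfield S 1
| gen_sub x y : gen_subfield S x -> gen_subfield S y -> gen_subfield S (x - y)
| gen_mul x y : gen_subfield S x -> gen_subfield S y -> gen_subfield S (x * y)
| gen_inv x : gen_subfield S x -> gen_subfield S x^-1.

Definition in_image (A B : Type) (f : A -> B) (y : B) : Prop :=
  exists x, f x = y.

Definition adjoin (F : fieldType) (E : F -> Prop) (a : F) : F -> Prop :=
  gen_subfield (fun x => E x \/ x = a).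

(* [radical_ext k E]: k = E_0 <= E_1 <= ... <= E_r = E inside F with
   E_(i+1) = E_i(a_i) and a_i ^+ m_i in E_i for some m_i > 0. *)
Inductive radical_ext (F : fieldType) (k : F -> Prop) : (F -> Prop) -> Prop :=
| radical_refl : radical_ext k k
| radical_adjoin E a m :
    radical_ext k E -> (0 < m)%N -> E (a ^+ m) -> radical_ext k (adjoin E a).

Definition alg_independent (k K : fieldType) (iota : {rmorphism k -> K})
    (m : nat) (v : 'I_m -> K) : Prop :=
  forall p : {mpoly k[m]}, mmap iota v p = 0 -> p = 0.

(* The entries of B and C, listed together as one family of n * n + n * n
   elements. *)
Definition entries (K : fieldType) (n : nat) (B C : 'M[K]_n) :
    'I_(n * n + n * n) -> K :=
  fun i => row_mx (mxvec B) (mxvec C) 0 i.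

Definition generic_pair (K : fieldType) (QtoK : {rmorphism rat -> K})
    (n : nat) (B C : 'M[K]_n) : Prop :=
  alg_independent QtoK (entries B C).

Definition generated_by_entries (K : fieldType) (QtoK : {rmorphism rat -> K})
    (n : nat) (B C : 'M[K]_n) : Prop :=
  forall x : K,
    gen_subfield (fun y => in_image QtoK y \/ in_image (entries B C) y) x.

(* The set of solutions has exactly N elements. *)
Definition has_card (T : eqType) (sol : T -> Prop) (N : nat) : Prop :=
  exists s : seq T, [/\ uniq s, size s = N & forall X, X \in s <-> sol X].

(* [sol] is the solution set, in matrices over an algebraic closure L of K, of
   a matrix equation over K. *)
Definition solvable_by_radicals (K : fieldType) (L : closedFieldType)
    (KtoL : {rmorphism K -> L}) (n : nat) (sol : 'M[L]_n -> Prop) : Prop :=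
  (exists2 N, (0 < N)%N & has_card sol N) /\
  (forall X, sol X ->
     exists2 E, radical_ext (in_image KtoL) E & forall i j, E (X i j)).

Definition is_solution (K : fieldType) (L : closedFieldType)
    (KtoL : {rmorphism K -> L}) (n : nat) (B C : 'M[K]_n) (X : 'M[L]_n) :
    Prop :=
  X *m X + map_mx KtoL B *m X + X *m map_mx KtoL B + map_mx KtoL C = 0.

(* Main.v *)
(* Put Y = X + B and A = B^2 - C: the equation becomes Y^2 = A.  Specialising
   the indeterminates to B = 0 and C = - diag(1, ..., n) shows that the
   discriminant of the characteristic polynomial of A and det A do not vanish, so
   A has n distinct nonzero eigenvalues.  A square root Y commutes with A, hence
   is diagonal in an eigenbasis of A and amounts to a choice of a square root
   of each eigenvalue: 2^n choices.  By Lagrange interpolation Y is a polynomial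
   in A whose coefficients are rational in the eigenvalues and their chosen
   square roots; for n <= 4 the formulas of Cardano and Ferrari express the
   eigenvalues by radicals. *)

Require Import Defs.
From mathcomp Require Import all_boot all_order all_algebra.
From mathcomp Require Import separable mpoly ring.

Set Implicit Arguments.
Unset Strict Implicit.
Unset Printing Implicit Defensive.

Import GRing.Theory.
Local Open Scope ring_scope.

(** * Subfields given by predicates *)

Record is_subfield (F : fieldType) (P : F -> Prop) : Prop := IsSubfield {
  sf1 : P 1;
  sfB : forall x y, P x -> P y -> P (x - y);
  sfM : forall x y, P x -> P y -> P (x * y);
  sfV : forall x, P x -> P x^-1 }.

Section Subfield.
Variables (F : fieldType) (P : F -> Prop).
Hypothesis sfP : is_subfield P.

Lemma sf0 : P 0.
Proof. by rewrite -(subrr 1); apply: (sfB sfP); apply: sf1. Qed.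

Lemma sfN x : P x -> P (- x).
Proof. by move=> Px; rewrite -sub0r; apply: (sfB sfP) => //; apply: sf0. Qed.

Lemma sfD x y : P x -> P y -> P (x + y).
Proof. by move=> Px Py; rewrite -[y]opprK; apply: (sfB sfP) => //; apply: sfN. Qed.

Lemma sfMn x n : P x -> P (x *+ n).
Proof.
by move=> Px; elim: n => [|n IHn]; [apply: sf0 | rewrite mulrS; apply: sfD].
Qed.

Lemma sfX x n : P x -> P (x ^+ n).
Proof.
by move=> Px; elim: n => [|n IHn]; [apply: sf1 | rewrite exprS; apply: (sfM sfP)].
Qed.

Lemma sf_sum I (r : seq I) (Q : pred I) (E : I -> F) :
  (forall i, P (E i)) -> P (\sum_(i <- r | Q i) E i).
Proof. by move=> PE; apply: big_ind => //; [apply: sf0 | apply: sfD]. Qed.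

End Subfield.

Ltac sf := repeat first
  [ assumption | apply: sf1 | apply: sf0 | apply: sfB | apply: sfN | apply: sfD
  | apply: sfM | apply: sfX | apply: sfMn | apply: sfV ].

Lemma in_image_subfield (K L : fieldType) (f : {rmorphism K -> L}) :
  is_subfield (in_image f).
Proof.
split=> [|_ _ [x <-] [y <-]|_ _ [x <-] [y <-]|_ [x <-]].
- by exists 1; rewrite rmorph1.
- by exists (x - y); rewrite rmorphB.
- by exists (x * y); rewrite rmorphM.
- by exists x^-1; rewrite fmorphV.
Qed.

Lemma gen_subfield_subfield (F : fieldType) (S : F -> Prop) :
  is_subfield (gen_subfield S).
Proof. by split; [apply: gen_one | apply: gen_sub | apply: gen_mul | apply: gen_inv]. Qed.

Lemma gen_subfield_min (F : fieldType) (S P : F -> Prop) :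
  is_subfield P -> (forall x, S x -> P x) -> forall x, gen_subfield S x -> P x.
Proof.
move=> sfP SP x; elim=> {x} [x /SP //||x y _ Px _ Py|x y _ Px _ Py|x _ Px]; sf.
Qed.

(** * Composita of radical extensions and their union *)

Section RadicalClosure.
Variables (F : fieldType) (k : F -> Prop).
Hypothesis sfk : is_subfield k.

Lemma radical_ext_subfield E : radical_ext k E -> is_subfield E.
Proof. by case=> // *; apply: gen_subfield_subfield. Qed.

Lemma radical_ext_base E x : radical_ext k E -> k x -> E x.
Proof. by move=> radE kx; elim: radE => // *; apply: gen_incl; left. Qed.

(** The tower of [E2] is replayed on top of [E1]: if a power of [a] lies in a step [E] of the old
    tower, it also lies in the larger field [E'] of the new one. *)
Lemma radical_ext_compositum E1 E2 : radical_ext k E1 -> radical_ext k E2 ->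
  exists E, [/\ radical_ext k E, forall x, E1 x -> E x & forall x, E2 x -> E x].
Proof.
move=> rad1; elim=> {E2} [|E a m radE [E' [radE' sE1 sE]] m0 Eam].
  by exists E1; split=> // x; apply: radical_ext_base.
exists (adjoin E' a); split=> [|x E1x|x].
- by apply: radical_adjoin radE' m0 _; apply: sE.
- by apply: gen_incl; left; apply: sE1.
- apply: (gen_subfield_min (P := adjoin E' a)); first exact: gen_subfield_subfield.
  by move=> y [Ey|->]; apply: gen_incl; [left; apply: sE | right].
Qed.

(** A single radical extension need not be closed under extraction of roots, but the union of all of
    them is a subfield that is. The root formulas can thus be applied inside it without tracking
    towers. *)
Definition radical_elt x := exists2 E, radical_ext k E & E x.

Lemma radical_elt_base x : k x -> radical_elt x.
Proof. by exists k => //; apply: radical_refl. Qed.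

Lemma radical_elt_family m (v : 'I_m -> F) : (forall i, radical_elt (v i)) ->
  exists2 E, radical_ext k E & forall i, E (v i).
Proof.
elim: m v => [|m IHm] v radv; first by exists k; [apply: radical_refl | case].
have [E radE Ev] := IHm _ (fun i => radv (lift ord0 i)).
have [E0 radE0 E0v] := radv ord0.
have [E' [radE' sE sE0]] := radical_ext_compositum radE radE0.
exists E' => // i; case: (unliftP ord0 i) => [j ->|->]; last exact: sE0.
exact: sE.
Qed.

Lemma radical_elt_subfield : is_subfield radical_elt.
Proof.
split=> [|x y [E1 rad1 E1x] [E2 rad2 E2y]|x y [E1 rad1 E1x] [E2 rad2 E2y]|x].
- by exists k; [apply: radical_refl | apply: sf1].
- have [E [radE s1 s2]] := radical_ext_compositum rad1 rad2.
  by exists E => //; apply: (sfB (radical_ext_subfield radE)); [apply: s1|apply: s2].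
- have [E [radE s1 s2]] := radical_ext_compositum rad1 rad2.
  by exists E => //; apply: (sfM (radical_ext_subfield radE)); [apply: s1|apply: s2].
- by case=> E radE Ex; exists E => //; apply: (sfV (radical_ext_subfield radE)).
Qed.

Lemma radical_elt_root x m : (0 < m)%N -> radical_elt (x ^+ m) -> radical_elt x.
Proof.
move=> m0 [E radE Exm]; exists (adjoin E x); first exact: radical_adjoin m0 Exm.
by apply: gen_incl; right.
Qed.

End RadicalClosure.

(** * Roots of polynomials of degree at most four *)

Section SmallDegree.
Variables (L : closedFieldType) (P : L -> Prop).
Hypothesis L0 : forall n, n.+1%:R != 0 :> L.
Hypothesis sfP : is_subfield P.
Hypothesis rootP : forall x m, (0 < m)%N -> P (x ^+ m) -> P x.

(** The square of [a - b] is symmetric in the two roots, so [a - b] lies in [P], and [a] is half of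
    [(a + b) + (a - b)]. *)
Lemma radical_quadratic a b : P (a + b) -> P (a * b) -> P a.
Proof.
move=> Ps Pp; have Pd : P (a - b).
  apply: (rootP (m := 2)) => //.
  have ->: (a - b) ^+ 2 = (a + b) ^+ 2 - (a * b) *+ 4 by ring.
  sf.
have ->: a = ((a + b) + (a - b)) * 2%:R^-1 by field; exact: L0.
sf.
Qed.

(* Cardano: y = 2 a - b - c is a root of y^3 - 3 w y - t with w, t symmetric;
   writing y = u + v with u v = w gives u^3 + v^3 = t and u^3 v^3 = w^3. *)
Lemma radical_cubic a b c :
  P (a + b + c) -> P (a * b + b * c + c * a) -> P (a * b * c) -> P a.
Proof.
set e1 := a + b + c; set e2 := _ + c * a; set e3 := a * b * c => P1 P2 P3.
pose w := e1 ^+ 2 - e2 *+ 3; pose y := a *+ 3 - e1.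
pose t := e1 ^+ 3 *+ 2 - e1 * e2 *+ 9 + e3 *+ 27.
(* The two numbers with sum [y] and product [w] are the roots of T^2 - y T + w; [u] is one of them
   and [v] will be the other. *)
have [u] : exists u, u ^+ 2 = y * u - w.
  have [u Hu] := solve_monicpoly (fun i => if i is 0 then - w else y) (n := 2) isT.
  exists u; rewrite Hu !big_ord_recl big_ord0 /=; ring.
move=> Hu; pose v := y - u.
have uv : u * v = w by rewrite /v mulrBr -expr2 Hu; ring.
have Ew : u ^+ 3 * v ^+ 3 = w ^+ 3 by rewrite -exprMn uv.
have Et : u ^+ 3 + v ^+ 3 = t.
  have ->: u ^+ 3 + v ^+ 3 = (u + v) ^+ 3 - (u * v) * (u + v) *+ 3 by ring.
  by rewrite uv /v [u + _]addrC subrK /t /y /w /e1 /e2 /e3; ring.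
have Pt : P t by rewrite /t; sf.
have Pw : P (w ^+ 3) by rewrite /w; sf.
have Pu : P u.
  by apply: (rootP (m := 3)) => //; apply: (radical_quadratic (b := v ^+ 3));
    rewrite ?Et ?Ew.
have Pv : P v.
  by apply: (rootP (m := 3)) => //; apply: (radical_quadratic (b := u ^+ 3));
    rewrite 1?addrC 1?mulrC ?Et ?Ew.
have ->: a = (u + v + e1) * 3%:R^-1 by rewrite /v /y; field; exact: L0.
sf.
Qed.

(* The three products (a + b)(c + d), (a + c)(b + d), (a + d)(b + c) are the
   roots of the resolvent cubic. *)
Lemma radical_quartic a b c d :
  P (a + b + c + d) -> P (a * b + a * c + a * d + b * c + b * d + c * d) ->
  P (a * b * c + a * b * d + a * c * d + b * c * d) -> P (a * b * c * d) -> P a.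
Proof.
move=> P1 P2 P3 P4.
(* Reorderings of the roots enter only through their elementary symmetric functions, so one claim
   serves for [a + b], [a + c] and [a + d]. Here [x + y] and [z + t] are the roots of a quadratic
   whose constant term is a root of the resolvent cubic. *)
have Pw x y z t : x + y + z + t = a + b + c + d ->
  x * y + x * z + x * t + y * z + y * t + z * t =
    a * b + a * c + a * d + b * c + b * d + c * d ->
  x * y * z + x * y * t + x * z * t + y * z * t =
    a * b * c + a * b * d + a * c * d + b * c * d ->
  x * y * z * t = a * b * c * d -> P (x + y).
  move=> E1 E2 E3 E4; apply: (radical_quadratic (b := z + t)).
    by rewrite addrA E1.
  apply: (radical_cubic (b := (x + z) * (y + t)) (c := (x + t) * (y + z))).
  - have ->: (x + y) * (z + t) + (x + z) * (y + t) + (x + t) * (y + z) =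
      (x * y + x * z + x * t + y * z + y * t + z * t) *+ 2 by ring.
    by rewrite E2; sf.
  - set e := (X in P X).
    have ->: e = (x * y + x * z + x * t + y * z + y * t + z * t) ^+ 2 +
      (x + y + z + t) * (x * y * z + x * y * t + x * z * t + y * z * t) -
      (x * y * z * t) *+ 4 by rewrite /e; ring.
    by rewrite E1 E2 E3 E4; sf.
  - set e := (X in P X).
    have ->: e = (x + y + z + t) * (x * y + x * z + x * t + y * z + y * t + z * t)
      * (x * y * z + x * y * t + x * z * t + y * z * t)
      - (x + y + z + t) ^+ 2 * (x * y * z * t)
      - (x * y * z + x * y * t + x * z * t + y * z * t) ^+ 2 by rewrite /e; ring.
    by rewrite E1 E2 E3 E4; sf.
have Pab : P (a + b) by apply: (Pw _ _ c d); ring.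
have Pac : P (a + c) by apply: (Pw _ _ b d); ring.
have Pad : P (a + d) by apply: (Pw _ _ b c); ring.
have ->: a = ((a + b) + (a + c) + (a + d) - (a + b + c + d)) * 2%:R^-1.
  by field; exact: L0.
sf.
Qed.

(** By Vieta, the coefficients are up to sign the elementary symmetric functions of [r]. Moving [x]
    to the front leaves one case for each number of remaining roots. *)
Lemma radical_roots (r : seq L) : (size r <= 4)%N ->
  (forall i, P (\prod_(x <- r) ('X - x%:P))`_i) -> forall x, x \in r -> P x.
Proof.
move=> szr Pr x xr; move: szr Pr.
rewrite (perm_size (perm_to_rem xr)) (perm_big _ (perm_to_rem xr)) /=.
have sfNN y : P (- y) -> P y by move=> Py; rewrite -[y]opprK; apply: sfN.
case: (rem x r) => [|b [|c [|d [|]]]] // _; rewrite !big_cons big_nil => Pr.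
- by move: (Pr 0%N); rewrite mulr1 !coefE sub0r => /sfNN.
- have Er : ('X - x%:P) * (('X - b%:P) * 1) =
    \poly_(i < 3) [:: x * b; - (x + b); 1]`_i.
    rewrite poly_def !big_ord_recl big_ord0 /= -!mul_polyC /bump /=.
    rewrite !(polyCN, polyCD, polyCM); ring.
  rewrite Er in Pr; have := (Pr 0%N, Pr 1%N); rewrite !coef_poly /=.
  by case=> P0 /sfNN P1; apply: (radical_quadratic (b := b)).
- have Er : ('X - x%:P) * (('X - b%:P) * (('X - c%:P) * 1)) =
    \poly_(i < 4) [:: - (x * b * c); x * b + b * c + c * x; - (x + b + c); 1]`_i.
    rewrite poly_def !big_ord_recl big_ord0 /= -!mul_polyC /bump /=.
    rewrite !(polyCN, polyCD, polyCM); ring.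
  rewrite Er in Pr; have := (Pr 0%N, Pr 1%N, Pr 2%N); rewrite !coef_poly /=.
  by case=> -[/sfNN P3 P2] /sfNN P1; apply: (radical_cubic (b := b) (c := c)).
- have Er : ('X - x%:P) * (('X - b%:P) * (('X - c%:P) * (('X - d%:P) * 1))) =
    \poly_(i < 5) [:: x * b * c * d;
      - (x * b * c + x * b * d + x * c * d + b * c * d);
      x * b + x * c + x * d + b * c + b * d + c * d; - (x + b + c + d); 1]`_i.
    rewrite poly_def !big_ord_recl big_ord0 /= -!mul_polyC /bump /=.
    rewrite !(polyCN, polyCD, polyCM); ring.
  rewrite Er in Pr.
  have := (Pr 0%N, Pr 1%N, Pr 2%N, Pr 3%N); rewrite !coef_poly /=.
  case=> -[[P4 /sfNN P3] P2] /sfNN P1.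
  exact: (radical_quartic (b := b) (c := c) (d := d)).
Qed.

End SmallDegree.

(** * Nonvanishing of the discriminant for generic matrices *)

Lemma map_resultant_comp (R S : nzRingType) (f : {rmorphism R -> S})
    (p q : {poly R}) :
  f (lead_coef p) != 0 -> f (lead_coef q) != 0 ->
  f (resultant p q) = resultant (map_poly f p) (map_poly f q).
Proof.
(* The leading coefficients survive under [f], so both degrees, and with them the shape of the
   Sylvester matrix, are preserved. *)
move=> fp0 fq0; rewrite /resultant /Sylvester_mx !size_map_poly_id0 //.
rewrite -det_map_mx; congr (\det _); apply/matrixP=> i j.
rewrite !mxE; case: split => k /[!mxE]/=;
  by rewrite -coef_map rmorphM /= map_rVpoly map_delta_mx.
Qed.

(** The coefficient [n.+1] does not vanish, so the degree drops by exactly one; this provides the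
    leading coefficient needed to map the resultant of [p] and its derivative. *)
Lemma lead_coef_deriv_monic (R : nzRingType) (p : {poly R}) n :
  p \is monic -> size p = n.+2 -> n.+1%:R != 0 :> R ->
  size p^`() = n.+1 /\ lead_coef p^`() = n.+1%:R.
Proof.
move=> monp szp n0.
have Ec : p^`()`_n = n.+1%:R.
  by rewrite coef_deriv -[n.+1]/(n.+2.-1) -szp -lead_coefE (monicP monp).
have szd : size p^`() = n.+1.
  apply/eqP; rewrite eqn_leq -ltnS -szp lt_size_deriv ?monic_neq0 //=.
  by rewrite leqNgt; apply: contraNN n0 => /leq_sizeP/(_ n (leqnn n)); rewrite Ec => ->.
by rewrite lead_coefE szd.
Qed.

(** The resultant is the discriminant of the characteristic polynomial up to sign. With the factor
    [\det A], over a field a single nonvanishing says that the eigenvalues are distinct and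
    nonzero. *)
Definition char_disc (R : comNzRingType) n (A : 'M[R]_n) : R :=
  resultant (char_poly A) (char_poly A)^`() * \det A.

Lemma map_char_disc (R S : comNzRingType) (f : {rmorphism R -> S}) n (A : 'M[R]_n.+1) :
  n.+1%:R != 0 :> S -> f (char_disc A) = char_disc (map_mx f A).
Proof.
move=> nS; have nR : n.+1%:R != 0 :> R.
  by apply: contraNneq nS => /(congr1 f); rewrite rmorph_nat rmorph0 => ->.
have [_ lcd] := lead_coef_deriv_monic (char_poly_monic A) (size_char_poly A) nR.
rewrite /char_disc rmorphM /= -map_char_poly deriv_map det_map_mx; congr (_ * _).
by rewrite map_resultant_comp ?lcd ?(monicP (char_poly_monic A)) ?rmorph1 ?rmorph_nat ?oner_neq0.
Qed.

Lemma char_disc_neq0 (F : fieldType) n (A : 'M[F]_n) :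
  (char_disc A != 0) = separable_poly (char_poly A) && (\det A != 0).
Proof.
rewrite /char_disc mulf_eq0 negb_or resultant_eq0; congr (_ && _).
rewrite unlock coprimep_def -leqNgt eqn_leq lt0n size_poly_eq0 gcdp_eq0.
by rewrite (negPf (monic_neq0 (char_poly_monic A))) andbT.
Qed.

(** One nonzero value shows that [p] is not the zero polynomial, and an algebraically independent
    family annihilates no other. *)
Lemma alg_independent_neq0 (k K : fieldType) (iota : {rmorphism k -> K}) m
    (v : 'I_m -> K) (p : {mpoly k[m]}) (w : 'I_m -> k) :
  alg_independent iota v -> p.@[w] != 0 -> mmap iota v p != 0.
Proof. by move=> vP; apply: contraNneq => /vP->; rewrite meval0. Qed.

Lemma rat_natS_neq0 (S : nzRingType) (f : {rmorphism rat -> S}) n :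
  n.+1%:R != 0 :> S.
Proof. by rewrite -(rmorph_nat f n.+1) fmorph_eq0 Num.Theory.pnatr_eq0. Qed.

(* The discriminant specialises to a nonzero value at B = 0,
   C = - diag(1, ..., n). *)
Lemma generic_char_disc (K : fieldType) (QtoK : {rmorphism rat -> K}) n
    (B C : 'M[K]_n.+1) :
  generic_pair QtoK B C -> char_disc (B *m B - C) != 0.
Proof.
set N := n.+1; move=> indep; pose R := {mpoly rat[N * N + N * N]}.
pose BX : 'M[R]_N := \matrix_(i, j) 'X_(lshift _ (mxvec_index i j)).
pose CX : 'M[R]_N := \matrix_(i, j) 'X_(rshift _ (mxvec_index i j)).
(* [BX] and [CX] are universal: every pair of matrices is an evaluation of them. This is applied to
   the generic pair and, with the identity of [rat], to the specialisation. *)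
have EX (S : fieldType) (f : {rmorphism rat -> S}) (B' C' : 'M[S]_N) :
    mmap f (entries B' C') (char_disc (BX *m BX - CX)) = char_disc (B' *m B' - C').
  pose phi : {rmorphism R -> S} := mmap f (entries B' C').
  rewrite -[LHS]/(phi _) map_char_disc; last exact: rat_natS_neq0 f _.
  have EB : map_mx phi BX = B'.
    by apply/matrixP=> i j; rewrite !mxE /phi /= mmapX mmap1U /entries row_mxEl mxvecE.
  have EC : map_mx phi CX = C'.
    by apply/matrixP=> i j; rewrite !mxE /phi /= mmapX mmap1U /entries row_mxEr mxvecE.
  by rewrite map_mxB map_mxM EB EC.
pose C0 : 'M[rat]_N := - diag_mx (\row_i i.+1%:R).
rewrite -(EX _ QtoK); apply: (alg_independent_neq0 (w := entries 0 C0) indep).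
rewrite /meval (EX _ idfun) mul0mx sub0r opprK char_disc_neq0.
rewrite char_poly_trig ?is_diag_mx_is_trig ?diag_mx_is_diag // det_diag.
apply/andP; split; last first.
  by apply/prodf_neq0 => i _; rewrite mxE Num.Theory.pnatr_eq0.
rewrite (eq_bigr (fun i : 'I_N => 'X - (i.+1%:R)%:P)); last first.
  by move=> i _; rewrite !mxE eqxx.
rewrite -(big_map (fun i : 'I_N => i.+1%:R) predT (fun x : rat => 'X - x%:P)).
rewrite separable_prod_XsubC map_inj_uniq ?index_enum_uniq // => i j /eqP.
by rewrite Num.Theory.eqr_nat => /eqP [/val_inj].
Qed.

(** * Square roots of a matrix with distinct eigenvalues *)

Lemma char_poly_conj (R : comUnitRingType) n (V A : 'M[R]_n) :
  V \in unitmx -> char_poly (invmx V *m A *m V) = char_poly A.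
Proof.
move=> Vu; pose W := map_mx polyC V; pose W' := map_mx polyC (invmx V).
have WW : W' *m W = 1%:M by rewrite -map_mxM mulVmx // map_mx1.
rewrite /char_poly.
have ->: char_poly_mx (invmx V *m A *m V) = W' *m char_poly_mx A *m W.
  rewrite /char_poly_mx mulmxBr mulmxBl !map_mxM; congr (_ - _).
  by rewrite scalar_mxC -mulmxA WW mulmx1.
by rewrite !det_mulmx mulrAC -det_mulmx WW det1 mul1r.
Qed.

(** The minimal polynomial divides the characteristic polynomial, here a product of distinct linear
    factors, so [A] is diagonalizable. *)
Lemma separable_char_poly_diag (L : closedFieldType) n (A : 'M[L]_n.+1) :
  separable_poly (char_poly A) ->
  exists V : 'M[L]_n.+1, exists D : 'rV[L]_n.+1,
    [/\ V \in unitmx, injective (D 0), A = invmx V *m diag_mx D *m V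
      & char_poly A = \prod_i ('X - (D 0 i)%:P)].
Proof.
move=> sepA; have [rs] := closed_field_poly_normal (char_poly A).
rewrite (monicP (char_poly_monic A)) scale1r => Ers.
have [|V Vu] := (diagonalizableP A).2.
  exists rs; first by rewrite -separable_prod_XsubC -Ers.
  by rewrite -Ers mxminpoly_dvd_char.
move=> /(similar_diagLR Vu)[D EA]; rewrite conjVmx // in EA.
have EcA : char_poly A = \prod_i ('X - (D 0 i)%:P).
  rewrite EA char_poly_conj // char_poly_trig ?is_diag_mx_is_trig ?diag_mx_is_diag //.
  by apply: eq_bigr => i _; rewrite mxE eqxx.
exists V, D; split=> //; move: sepA.
rewrite EcA -big_enum -(big_map (D 0) predT (fun x => 'X - x%:P)) separable_prod_XsubC.
exact/injectiveP.
Qed.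

Section SquareRoots.
Variables (L : closedFieldType) (n : nat) (V : 'M[L]_n.+1) (D : 'rV[L]_n.+1).
Hypotheses (Vu : V \in unitmx) (Dinj : injective (D 0)).

Definition conj_diag (z : 'rV[L]_n.+1) := invmx V *m diag_mx z *m V.

Lemma conj_diag_inj : injective conj_diag.
Proof.
move=> y z /(congr1 (fun M => V *m M *m invmx V)).
rewrite /conj_diag !mulmxA mulmxV // !mul1mx -!mulmxA mulmxV // !mulmx1.
by move=> /matrixP E; apply/rowP=> i; move: (E i i); rewrite !mxE eqxx.
Qed.

Lemma sqrt_conj_diag (Y : 'M[L]_n.+1) :
  Y *m Y = conj_diag D <->
  exists2 z : 'rV_n.+1, (forall i, z 0 i ^+ 2 = D 0 i) & Y = conj_diag z.
Proof.
split=> [YY|[z zD ->]]; last first.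
  rewrite /conj_diag !mulmxA mulmxK // -[_ *m diag_mx z *m diag_mx z]mulmxA.
  by rewrite mulmx_diag; congr (_ *m diag_mx _ *m _); apply/rowP=> i;
    rewrite !mxE -zD expr2.
pose Z := V *m Y *m invmx V.
have EY : Y = invmx V *m Z *m V by rewrite /Z !mulmxA mulVmx // mul1mx mulmxKV.
have ZZ : Z *m Z = diag_mx D.
  rewrite /Z !mulmxA mulmxKV // -[V *m Y *m Y]mulmxA YY /conj_diag.
  by rewrite !mulmxA mulmxV // mul1mx mulmxK.
(* [Z] commutes with its own square, so its (i, j) entry is annihilated by the difference of the
   i-th and j-th entries of [D], which is nonzero off the diagonal. *)
have Zdiag : is_diag_mx Z.
  apply/is_diag_mxP=> i j ij; have /matrixP/(_ i j) : Z *m diag_mx D = diag_mx D *m Z.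
    by rewrite -ZZ mulmxA.
  rewrite mul_mx_diag mul_diag_mx !mxE mulrC => /eqP.
  rewrite -subr_eq0 -mulrBl mulf_eq0 subr_eq0 => /orP[/eqP/Dinj ji|/eqP//].
  by rewrite ji eqxx in ij.
have [z Ez] := diag_mxP _ Zdiag; exists z; last by rewrite EY Ez.
move=> i; have /matrixP/(_ i i) := ZZ; rewrite Ez mulmx_diag !mxE eqxx !mulr1n => <-.
by rewrite expr2.
Qed.

(** The entries of [V] need not lie in [P]. Interpolation removes [V]: if [q] takes each [D 0 k] to
    [z 0 k], then [conj_diag z] is [q] evaluated at [conj_diag D]. *)
Lemma conj_diag_subfield (P : L -> Prop) (z : 'rV[L]_n.+1) :
  is_subfield P -> (forall i j, P (conj_diag D i j)) -> (forall i, P (D 0 i)) ->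
  (forall i, P (z 0 i)) -> forall i j, P (conj_diag z i j).
Proof.
move=> sfP PA PD Pz.
(* The Lagrange basis polynomial, equal to 1 at [D 0 k] and to 0 at the other nodes. *)
pose ell k : {poly L} :=
  \prod_(l | l != k) ((D 0 k - D 0 l)^-1 *: ('X - (D 0 l)%:P)).
pose q := \sum_k z 0 k *: ell k.
have Eq k : q.[D 0 k] = z 0 k.
  rewrite horner_sum (bigD1 k) //= big1 => [|l lk].
    rewrite addr0 hornerZ horner_prod big1 ?mulr1 // => l lk.
    rewrite hornerZ hornerXsubC mulVf // subr_eq0.
    by apply: contraNneq lk => /Dinj ->.
  by rewrite hornerZ horner_prod (bigD1 k) 1?eq_sym //= hornerZ hornerXsubC subrr !(mulr0, mul0r).
have ->: conj_diag z = horner_mx (conj_diag D) q.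
  rewrite horner_mx_uconjC // horner_mx_diag; congr (_ *m diag_mx _ *m _).
  by apply/rowP=> i; rewrite !mxE Eq.
pose PM (M : 'M[L]_n.+1) := forall i j, P (M i j).
have PM1 : PM 1 by move=> i j; rewrite mxE; apply: sfMn => //; apply: sf1.
have PMB M N : PM M -> PM N -> PM (M - N).
  by move=> PMM PMN i j; rewrite !mxE; apply: (sfB sfP).
have PMD M N : PM M -> PM N -> PM (M + N).
  by move=> PMM PMN i j; rewrite !mxE; apply: (sfD sfP).
have PMM M N : PM M -> PM N -> PM (M * N).
  move=> PMM PMN i j; rewrite mxE; apply: (sf_sum sfP) => k.
  exact: (sfM sfP).
have PMZ a M : P a -> PM M -> PM (a *: M).
  by move=> Pa PMM' i j; rewrite mxE; apply: (sfM sfP).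
have PM0 : PM 0 by rewrite -(subrr 1); apply: (PMB).
suff: PM (horner_mx (conj_diag D) q) by [].
(* [q] is evaluated in factored form, so its coefficients never have to be computed. *)
rewrite rmorph_sum; apply: big_ind => //= k _.
rewrite linearZ; apply: (PMZ) => //.
rewrite rmorph_prod; apply: big_ind => //= l _.
rewrite linearZ; apply: (PMZ); first by apply: (sfV sfP); apply: (sfB sfP).
rewrite rmorphB /= horner_mx_X horner_mx_C; apply: (PMB) => // i j.
by rewrite mxE; apply: sfMn.
Qed.

End SquareRoots.

(** * Completing the square and counting the solutions *)

Lemma is_solutionE (K : fieldType) (L : closedFieldType)
    (KtoL : {rmorphism K -> L}) n (B C : 'M[K]_n) (X : 'M[L]_n) :
  is_solution KtoL B C X <->
  (X + map_mx KtoL B) *m (X + map_mx KtoL B) = map_mx KtoL (B *m B - C).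
Proof.
rewrite /is_solution map_mxB map_mxM mulmxDl !mulmxDr.
set b := map_mx KtoL B; set c := map_mx KtoL C.
(* Both [b *m X] and [X *m b] occur in the equation, so the square is completed without
   commutativity. *)
have ->: X *m X + b *m X + X *m b + c =
    (X *m X + X *m b + (b *m X + b *m b)) - (b *m b - c).
  by rewrite opprB [c - _]addrC !addrA addrK [X *m X + b *m X + _]addrAC.
by split=> [/eqP|->]; rewrite ?subrr // subr_eq0 => /eqP.
Qed.

(** After fixing one root [s i] of each eigenvalue, the square roots correspond to sign vectors;
    different signs give different matrices because [s i] is nonzero and -1 differs from 1. *)
Lemma conj_diag_sqrts_card (L : closedFieldType) n (V : 'M[L]_n.+1) (D : 'rV[L]_n.+1) :
  2%:R != 0 :> L -> V \in unitmx -> injective (D 0) -> (forall i, D 0 i != 0) ->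
  has_card (fun Y : 'M[L]_n.+1 => Y *m Y = conj_diag V D) (2 ^ n.+1).
Proof.
move=> L2 Vu Dinj D0.
have /fin_all_exists[s sD] (i : 'I_n.+1) : exists x, x ^+ 2 = D 0 i.
  have [x Ex] := solve_monicpoly (fun j => if j is 0 then D 0 i else 0) (n := 2) isT.
  by exists x; rewrite Ex !big_ord_recl big_ord0 /= expr0 mulr1 mul0r !addr0.
have s0 i : s i != 0 by rewrite -sqrf_eq0 sD.
pose z (e : {ffun 'I_n.+1 -> bool}) : 'rV[L]_n.+1 := \row_i ((-1) ^+ e i * s i).
have z_inj : injective z.
  move=> e e' /rowP E; apply/ffunP=> i; move: (E i); rewrite !mxE => /(mulIf (s0 i)).
  have N1 : (-1 : L) != 1 by rewrite eq_sym -subr_eq0 opprK.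
  by case: (e i) (e' i) => [] [] //; rewrite expr0 expr1 => /eqP; rewrite ?[1 == _]eq_sym (negPf N1).
exists [seq conj_diag V (z e) | e : {ffun 'I_n.+1 -> bool}]; split.
- by rewrite map_inj_uniq ?enum_uniq //; apply: inj_comp z_inj; apply: conj_diag_inj.
- by rewrite size_map -cardE card_ffun card_bool card_ord.
- move=> Y; rewrite (sqrt_conj_diag Vu Dinj); split=> [/mapP[e _ ->]|[y yD ->]].
    by exists (z e) => // i; rewrite mxE exprMn sD sqrr_sign mul1r.
  (* The sign is negative exactly where [y] departs from the reference root. *)
  apply/mapP; exists [ffun i => y 0 i != s i]; first by rewrite mem_enum.
  congr conj_diag; apply/rowP=> i; rewrite mxE ffunE.
  have /eqP := yD i; rewrite -sD eqf_sqr => /orP[/eqP ->|/eqP E].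
    by rewrite eqxx mul1r.
  by case: eqP => [->|_]; rewrite ?mul1r // mulN1r E.
Qed.

Lemma has_card_bij (T U : eqType) (f : T -> U) (g : U -> T)
    (P : T -> Prop) (Q : U -> Prop) N :
  cancel f g -> cancel g f -> (forall x, Q (f x) <-> P x) ->
  has_card P N -> has_card Q N.
Proof.
move=> fK gK PQ [s [us szs sP]]; exists (map f s); split.
- by rewrite map_inj_uniq //; apply: can_inj fK.
- by rewrite size_map.
- by move=> y; rewrite -[y]gK (mem_map (can_inj fK)) sP; split=> /PQ.
Qed.

(* K = Q(entries of B and C); L, with the embedding KtoL, is an algebraic
   closure of K. *)
Theorem proposition1 (n : nat) (hn : (2 <= n)%N)
    (K : fieldType) (QtoK : {rmorphism rat -> K}) (B C : 'M[K]_n)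
    (hBC : generic_pair QtoK B C)
    (hK : generated_by_entries QtoK B C)
    (L : closedFieldType) (KtoL : {rmorphism K -> L})
    (hL : integralRange KtoL) :
  has_card (is_solution KtoL B C) (2 ^ n)%N /\
  ((n <= 4)%N -> solvable_by_radicals KtoL (is_solution KtoL B C)).
Proof.
case: n hn B C hBC hK => // n _ B C hBC _.
have L0 m : m.+1%:R != 0 :> L := rat_natS_neq0 (KtoL \o QtoK) m.
set b := map_mx KtoL B; set A := map_mx KtoL (B *m B - C).
(* Genericity gives nonvanishing over [K], and the injective map to [L] preserves it. *)
have : char_disc A != 0 by rewrite -map_char_disc // fmorph_eq0 (generic_char_disc hBC).
rewrite char_disc_neq0 => /andP[sepA detA].
have [V [D [Vu Dinj EA EcA]]] := separable_char_poly_diag sepA.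
have D0 i : D 0 i != 0.
  move: detA; rewrite EA !det_mulmx det_diag !mulf_eq0 !negb_or.
  by case/andP=> /andP[_ /prodf_neq0/(_ i isT)].
have solE X : is_solution KtoL B C X <-> (X + b) *m (X + b) = conj_diag V D.
  by rewrite is_solutionE /conj_diag -EA.
have card : has_card (is_solution KtoL B C) (2 ^ n.+1).
  apply: (has_card_bij (f := fun Y => Y - b) (g := fun X => X + b)); last first.
  - exact: (conj_diag_sqrts_card (L0 1%N) Vu Dinj D0).
  - by move=> Y; rewrite solE subrK.
  - exact: addrK.
  - exact: subrK.
split=> // n4; split; first by exists (2 ^ n.+1)%N; rewrite ?expn_gt0.
pose k := in_image KtoL; pose P := radical_elt k.
have sfk : is_subfield k := in_image_subfield KtoL.
have sfP : is_subfield P := radical_elt_subfield sfk.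
have rootP x m : (0 < m)%N -> P (x ^+ m) -> P x := @radical_elt_root _ k x m.
have Pk x : P (KtoL x) by apply: radical_elt_base; exists x.
(* The bound on the size enters here: the eigenvalues are the roots of a characteristic polynomial
   with coefficients from [K], of degree at most four. *)
have PD i : P (D 0 i).
  apply: (radical_roots L0 sfP rootP (r := [seq D 0 j | j <- enum 'I_n.+1])).
  - by rewrite size_map size_enum_ord.
  - move=> j; rewrite big_map big_enum -EcA -map_char_poly coef_map; exact: Pk.
  - by apply: map_f; rewrite mem_enum.
move=> X /solE/(sqrt_conj_diag Vu Dinj)[z zD EX].
have PX i j : P (X i j).
  rewrite -[X](addrK b) EX mxE [(- b) i j]mxE [b i j]mxE.
  apply: (sfB sfP) (Pk _); apply: (conj_diag_subfield Vu Dinj) => // [i' j'|i'].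
    by rewrite /conj_diag -EA mxE; apply: Pk.
  by apply: (rootP _ 2%N) => //; rewrite zD.
(* Solvability asks for a single radical extension containing all entries, so [X] is flattened into
   one finite family. *)
have PvX i : P (mxvec X 0 i).
  by case/mxvec_indexP: i => i j; rewrite mxvecE; apply: PX.
have [E radE EE] := radical_elt_family PvX.
by exists E => // i j; rewrite -(mxvecE X).
Qed.
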